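(* There is a constant $C$ such that for every sufficiently large $n$ there exists a $C_4$-free $1$-planar graph on $n$ vertices with at least $2.4n-C$ edges.
   Context: All graphs are finite and simple. A graph is $k$-planar if it admits a drawing in the plane in which every edge is crossed at most $k$ times. A graph is $C_\ell$-free if it contains no cycle of length $\ell$ as a subgraph. (The paper states the edge count as $2.4n-O(1)$.) *)

(* Defs.v *)
From Stdlib Require Import Reals.
From mathcomp Require Import all_boot.

Set Implicit Arguments.
Unset Strict Implicit.
Unset Printing Implicit Defensive.

Definition point := (R * R)%type.

Definition simple_graph (n : nat) (e : rel 'I_n) : Prop :=
  symmetric e /\ irreflexive e.

Definition num_edges (n : nat) (e : rel 'I_n) : nat :=
  #|[set p : 'I_n * 'I_n | (p.1 < p.2)%N && e p.1 p.2]|.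

Definition C4_free (n : nat) (e : rel 'I_n) : Prop :=
  forall a b c d : 'I_n,
    uniq [:: a; b; c; d] -> e a b -> e b c -> e c d -> e d a -> False.

(** A simple arc: a continuous map R -> R^2 (only its restriction to [0,1]
    matters; every continuous path on [0,1] extends continuously to R) that is
    injective on [0,1]. *)
Definition is_arc (f : R -> point) : Prop :=
  (forall t : R, continuity_pt (fun s => fst (f s)) t /\
                 continuity_pt (fun s => snd (f s)) t) /\
  (forall s t : R, (Rle 0 s /\ Rle s 1) -> (Rle 0 t /\ Rle t 1) -> f s = f t -> s = t).

Definition good_drawing (n : nat) (e : rel 'I_n)
    (pos : 'I_n -> point) (arc : 'I_n -> 'I_n -> R -> point) : Prop :=
  injective pos /\
  forall u v : 'I_n, (u < v)%N -> e u v ->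
    is_arc (arc u v) /\ arc u v R0 = pos u /\ arc u v R1 = pos v /\
    (forall (w : 'I_n) (t : R), (Rlt 0 t /\ Rlt t 1) -> arc u v t <> pos w).

Definition crossing (n : nat) (e : rel 'I_n) (arc : 'I_n -> 'I_n -> R -> point)
    (u v x y : 'I_n) (p : point) : Prop :=
  (x < y)%N /\ e x y /\ (x, y) <> (u, v) /\
  exists s t : R, (Rlt 0 s /\ Rlt s 1) /\ (Rlt 0 t /\ Rlt t 1) /\ arc u v s = p /\ arc x y t = p.

(** 1-planar drawing: every edge has at most one crossing (a crossing being a
    pair (other edge, common interior point)). *)
Definition one_planar_drawing (n : nat) (e : rel 'I_n)
    (pos : 'I_n -> point) (arc : 'I_n -> 'I_n -> R -> point) : Prop :=
  good_drawing e pos arc /\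
  forall u v : 'I_n, (u < v)%N -> e u v ->
    forall (x1 y1 x2 y2 : 'I_n) (p1 p2 : point),
      crossing e arc u v x1 y1 p1 -> crossing e arc u v x2 y2 p2 ->
      x1 = x2 /\ y1 = y2 /\ p1 = p2.

Definition one_planar (n : nat) (e : rel 'I_n) : Prop :=
  exists pos arc, one_planar_drawing e pos arc.

(* Main.v *)
Require Import Defs.
From Stdlib Require Import Reals ZArith Lia Lra.
From mathcomp Require Import all_boot zify ssrZ.

(** The graph is 10-periodic on a helix: vertex [i] lies at height [i] on a
    cylinder of circumference 10, every ten consecutive vertices send 24 edges
    upwards, each of vertical extent at most 11, and edges are straight on the
    cylinder.  Absence of 4-cycles and of second crossings is then a finite
    check modulo translation by 10.  The cylinder embeds in the plane by
    [(x, y) |-> exp y * (cos (pi x / 5), sin (pi x / 5))], and truncating to [n]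
    vertices loses only boundedly many edges. *)

Set Implicit Arguments.
Unset Strict Implicit.
Unset Printing Implicit Defensive.

(* The key [R] belongs to [ring_scope] here. *)
Delimit Scope R_scope with Re.

(** * Embedding the cylinder in the plane *)

Definition wrap (x y : R) : point :=
  (exp y * cos (x * (PI / 5)), exp y * sin (x * (PI / 5)))%Re.

Lemma wrap_period (x y : R) (k : Z) : wrap (x + 10 * IZR k) y = wrap x y.
Proof.
have nat_period (m : nat) z : wrap (z + 10 * INR m) y = wrap z y.
  rewrite /wrap.
  have -> : ((z + 10 * INR m) * (PI / 5) = z * (PI / 5) + 2 * INR m * PI)%Re
    by field.
  by rewrite cos_period sin_period.
have [k_ge0|k_lt0] := Z_le_gt_dec 0 k.
  by rewrite -(Z2Nat.id k) // -INR_IZR_INZ nat_period.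
rewrite -(nat_period (Z.to_nat (- k)) (x + 10 * IZR k)%Re).
rewrite INR_IZR_INZ Z2Nat.id ?opp_IZR; last lia.
by congr wrap; ring.
Qed.

(** By the half-angle formula [cos a = 1 - 2 * sin (a / 2) ^ 2], so [a / 2] is a zero of the
    sine. *)
Lemma cos_eq_1_period (a : R) : cos a = 1%Re -> exists k : Z, a = (2 * PI * IZR k)%Re.
Proof.
move=> ca.
have s0 : sin (a / 2) = 0%Re.
  have := cos_2a_sin (a / 2); have -> : (2 * (a / 2) = a)%Re by field.
  by rewrite ca => ?; nra.
have [k ak] := sin_eq_0_0 _ s0.
by exists k; lra.
Qed.

(** The norm of the point is [exp y], which fixes the height; once it is divided out, the difference
    of the two angles has cosine 1. *)
Lemma wrap_inj (x y x' y' : R) :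
  wrap x y = wrap x' y' -> y = y' /\ exists k : Z, x = (x' + 10 * IZR k)%Re.
Proof.
case=> ec es.
have e0 := exp_pos y; have e0' := exp_pos y'.
have ee : exp y = exp y'.
  have : (exp y * exp y = exp y' * exp y')%Re.
    have sqr a z : (a * a = (a * cos z) * (a * cos z) + (a * sin z) * (a * sin z))%Re.
      by have := sin2_cos2 z; rewrite /Rsqr => h; nra.
    by rewrite (sqr _ (x * (PI / 5))%Re) ec es -sqr.
  by move=> ?; nra.
split; first exact: exp_inv.
rewrite ee in ec es.
move/Rmult_eq_reg_l: ec => /(_ ltac:(lra)) ec.
move/Rmult_eq_reg_l: es => /(_ ltac:(lra)) es.
have [k hk] : exists k : Z, (x * (PI / 5) - x' * (PI / 5) = 2 * PI * IZR k)%Re.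
  by apply: cos_eq_1_period; rewrite cos_minus ec es; have := sin2_cos2 (x' * (PI / 5)); rewrite /Rsqr; lra.
exists k; have P0 := PI_RGT_0.
by apply: (Rmult_eq_reg_r (PI / 5)); lra.
Qed.

(* Vertex [i] sits at [(col i, i)] in the cylinder [R/10Z x R], and [(s, d)] in
   the row of [i mod 10] is the edge from [i] to [i + s] drawn with displacement
   [(d, s)].  The tables were found by computer search. *)
Definition col_tbl : seq Z := [:: 8; 0; 5; 5; 3; 9; 1; 3; 6; 1]%Z.

Definition step_tbl : seq (seq (nat * Z)) :=
  [:: [:: (5, 1%Z); (6, 3%Z)];
      [:: (3, 3%Z); (5, 1%Z); (6, 3%Z)];
      [:: (6, 1%Z)];
      [:: (1, (-2)%Z); (2, 4%Z); (5, 1%Z)];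
      [:: (4, 3%Z); (9, 2%Z); (11, 6%Z)];
      [:: (4, 2%Z); (5, (-1)%Z)];
      [:: (5, (-1)%Z); (8, 2%Z)];
      [:: (2, (-2)%Z); (5, 2%Z); (11, 3%Z)];
      [:: (3, 4%Z); (4, (-1)%Z); (8, 5%Z)];
      [:: (2, (-1)%Z); (8, 2%Z)]].

Definition col (i : nat) : Z := nth 0%Z col_tbl (i %% 10).
Definition steps (i : nat) : seq (nat * Z) := nth [::] step_tbl (i %% 10).
(** For [j <= i] the truncated difference is 0, which is no step length in the table, so the
    relation forces [i < j]. *)
Definition up (i j : nat) : bool := j - i \in unzip1 (steps i).
Definition adj (i j : nat) : bool := up i j || up j i.
Definition dx (i j : nat) : Z :=
  (nth (0, 0%Z) (steps i) (index (j - i) (unzip1 (steps i)))).2.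

Definition arcs (i j : nat) (t : R) : point :=
  wrap (IZR (col i) + t * IZR (dx i j))
       (IZR (Z.of_nat i) + t * (IZR (Z.of_nat j) - IZR (Z.of_nat i))).

Definition dots (i : nat) : point := wrap (IZR (col i)) (IZR (Z.of_nat i)).

(** * Vertices and edges on the cylinder *)

Lemma mod10_lt (i : nat) : i %% 10 < 10. Proof. by rewrite ltn_mod. Qed.

Lemma all_mod10 (p : pred nat) (i : nat) : all p (iota 0 10) -> p (i %% 10).
Proof. by move/allP; apply; rewrite mem_iota /= mod10_lt. Qed.

Lemma all_steps (p : pred (nat * Z)) (i : nat) :
  all (all p) step_tbl -> all p (steps i).
Proof.
by move/allP => h; apply: h; rewrite /steps mem_nth //= mod10_lt.
Qed.

Lemma mem_steps (i j : nat) : up i j -> (j - i, dx i j) \in steps i.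
Proof.
rewrite /up /dx; set l := steps i => uij.
have lt : index (j - i) (unzip1 l) < size l by rewrite -(size_map fst) index_mem.
rewrite [X in (X, _) \in _](_ : _ = (nth (0, 0%Z) l (index (j - i) (unzip1 l))).1).
  by rewrite -surjective_pairing; apply: mem_nth.
by rewrite -(nth_map _ 0) // nth_index.
Qed.

Lemma up_bounds (i j : nat) : up i j ->
  [/\ i < j, j <= i + 11 & (-6 <= dx i j <= 6)%Z].
Proof.
move=> uij.
pose p (s : nat * Z) := [&& 0 < s.1, s.1 <= 11, (-6 <=? s.2)%Z & (s.2 <=? 6)%Z].
have /allP h : all p (steps i) by exact: all_steps.
by case/and4P: (h _ (mem_steps uij)) => /= ? ? /Z.leb_spec0 ? /Z.leb_spec0 ?; split; lia.
Qed.

Lemma col_bounds (i : nat) : (0 <= col i <= 9)%Z.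
Proof.
have := @all_mod10 (fun a => (0 <=? nth 0 col_tbl a)%Z && (nth 0 col_tbl a <=? 9)%Z) i isT.
by case/andP => /Z.leb_spec0 ? /Z.leb_spec0 ?.
Qed.

(** Compatibility of the two tables: an edge drawn with its tabulated displacement ends at its upper
    vertex on the cylinder. Everything depends on [i] modulo 10 only, so ten residues are
    checked. *)
Lemma col_end (i j : nat) : up i j ->
  exists k : Z, (col i + dx i j = col j + 10 * k)%Z.
Proof.
pose p i := all (fun s : nat * Z =>
  ((col i + s.2 - col (i + s.1)) mod 10 =? 0)%Z) (steps i).
move=> uij; have [ij _ _] := up_bounds uij.
have : p (i %% 10) by apply: all_mod10; vm_compute.
have es : steps (i %% 10) = steps i by rewrite /steps modn_mod.
have e1 : col (i %% 10) = col i by rewrite /col modn_mod.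
have e2 : col (i %% 10 + (j - i)) = col j by rewrite /col modnDml subnKC // ltnW.
rewrite /p es => /allP ph.
have h := ph _ (mem_steps uij); rewrite /= e1 e2 in h; move/Z.eqb_spec: h => h.
have [q eq] := proj1 (Z.mod_divide _ 10 ltac:(lia)) h.
by exists q; lia.
Qed.

Lemma arcs0 (i j : nat) : arcs i j R0 = dots i.
Proof. by rewrite /arcs /dots !Rmult_0_l !Rplus_0_r. Qed.

Lemma arcs1 (i j : nat) : up i j -> arcs i j R1 = dots j.
Proof.
move=> /col_end [k ek]; rewrite /arcs /dots !Rmult_1_l -plus_IZR ek.
by rewrite plus_IZR mult_IZR wrap_period; congr wrap; ring.
Qed.

Lemma dots_inj : injective dots.
Proof. by move=> i j /wrap_inj [/eq_IZR] /Nat2Z.inj. Qed.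

(** Injectivity is read off the height, which increases strictly along an edge. *)
Lemma arcs_is_arc (i j : nat) : up i j -> is_arc (arcs i j).
Proof.
move=> /up_bounds [ij _ _]; split=> [t|s t _ _ /wrap_inj [e _]].
  split; apply: derivable_continuous_pt; rewrite /arcs /wrap /=; reg.
have : (0 < IZR (Z.of_nat j) - IZR (Z.of_nat i))%Re.
  by apply: Rlt_Rminus; apply: IZR_lt; lia.
by move=> d; apply: (Rmult_eq_reg_r (IZR (Z.of_nat j) - IZR (Z.of_nat i))); lra.
Qed.

(** * Intersection of segments with integer data *)

Definition cross (a b c d : Z) : Z := (a * d - b * c)%Z.

(* Segments [(0, 0) -- (a, b)] and [(p, q) -- (p + c, q + d)], the parameters
   of the intersection being the quotients of Cramer's rule; parallel segments
   on a common line are reported as meeting. *)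
Definition meetb (a b c d p q : Z) : bool :=
  let D := cross a b c d in
  let between n := ((0 <? n * D) && (n * D <? D * D))%Z in
  if (D =? 0)%Z then (cross p q a b =? 0)%Z
  else between (cross p q c d) && between (cross p q a b).

(** Taking determinants with [(c, d)] and with [(a, b)] eliminates [t] and [s] in turn. The equation
    for [s] is kept because it fixes the crossing point once the determinant is nonzero. *)
Lemma meetP (a b c d p q : Z) (s t : R) :
  (0 < s < 1)%Re -> (0 < t < 1)%Re ->
  (s * IZR a = IZR p + t * IZR c)%Re -> (s * IZR b = IZR q + t * IZR d)%Re ->
  meetb a b c d p q /\ (s * IZR (cross a b c d) = IZR (cross p q c d))%Re.
Proof.
move=> s01 t01 e1 e2.
have es : (s * IZR (cross a b c d) = IZR (cross p q c d))%Re.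
  rewrite /cross !minus_IZR !mult_IZR; nra.
have et : (t * IZR (cross a b c d) = IZR (cross p q a b))%Re.
  rewrite /cross !minus_IZR !mult_IZR; nra.
split=> //; rewrite /meetb; case: Z.eqb_spec => D0.
  by apply/Z.eqb_spec; apply: eq_IZR; rewrite -et D0; ring.
(* Multiplying [0 < n / D < 1] by the square of [D] avoids a case split on the sign of [D]. *)
have between (r : R) n : (0 < r < 1)%Re -> (r * IZR (cross a b c d) = IZR n)%Re ->
    ((0 <? n * cross a b c d) && (n * cross a b c d <? cross a b c d * cross a b c d))%Z.
  move=> r01 er; have D2 : (0 < IZR (cross a b c d) * IZR (cross a b c d))%Re.
    by rewrite -mult_IZR; apply: IZR_lt; nia.
  by apply/andP; split; apply/Z.ltb_spec0; apply: lt_IZR; rewrite !mult_IZR -er; nra.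
by rewrite (between s) // (between t).
Qed.

(** * Translation by multiples of 10 *)

Lemma col_shift (m i : nat) : col (i + m * 10) = col i.
Proof. by rewrite /col addnC modnMDl. Qed.

Lemma up_shift (m i j : nat) : up (i + m * 10) (j + m * 10) = up i j.
Proof. by rewrite /up /steps subnDr (addnC i) modnMDl. Qed.

Lemma dx_shift (m i j : nat) : dx (i + m * 10) (j + m * 10) = dx i j.
Proof. by rewrite /dx /steps subnDr (addnC i) modnMDl. Qed.

(* Translates [u] by a multiple of 10 into [30, 40), so that everything within
   distance 30 of [u] lands in the window [0, 70). *)
Definition recenter (u i : nat) : nat := i + 30 - u %/ 10 * 10.

(** The hypothesis keeps the subtraction in [recenter] from truncating. Both sides are upward
    translates because [recenter u i] may lie on either side of [i]. *)
Lemma recenter_shift (u i : nat) :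
  u <= i + 30 -> recenter u i + u %/ 10 * 10 = i + 3 * 10.
Proof. by rewrite /recenter; lia. Qed.

Lemma recenter_lt (u i : nat) : i <= u + 30 -> recenter u i < 70.
Proof. by rewrite /recenter; lia. Qed.

Lemma recenter_self (u : nat) : recenter u u \in iota 30 10.
Proof. by rewrite mem_iota /recenter; lia. Qed.

Lemma recenter_inj (u i j : nat) :
  u <= i + 30 -> u <= j + 30 -> recenter u i = recenter u j -> i = j.
Proof. by rewrite /recenter; lia. Qed.

Lemma recenter_sub (u i j : nat) : u <= i + 30 -> u <= j + 30 ->
  (Z.of_nat (recenter u i) - Z.of_nat (recenter u j) = Z.of_nat i - Z.of_nat j)%Z.
Proof. by rewrite /recenter; lia. Qed.

Lemma col_recenter (u i : nat) : u <= i + 30 -> col (recenter u i) = col i.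
Proof. by move=> /recenter_shift e; rewrite -(col_shift (u %/ 10)) e col_shift. Qed.

Lemma up_recenter (u i j : nat) : u <= i + 30 -> u <= j + 30 ->
  up (recenter u i) (recenter u j) = up i j.
Proof.
move=> /recenter_shift ei /recenter_shift ej.
by rewrite -(up_shift (u %/ 10)) ei ej up_shift.
Qed.

Lemma dx_recenter (u i j : nat) : u <= i + 30 -> u <= j + 30 ->
  dx (recenter u i) (recenter u j) = dx i j.
Proof.
move=> /recenter_shift ei /recenter_shift ej.
by rewrite -(dx_shift (u %/ 10)) ei ej dx_shift.
Qed.

(** * Absence of 4-cycles *)

Lemma adj_dist (i j : nat) : adj i j -> i <= j + 11 /\ j <= i + 11.
Proof. by case/orP=> /up_bounds [? ? _]; lia. Qed.

Lemma adj_recenter (u i j : nat) : u <= i + 30 -> u <= j + 30 ->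
  adj (recenter u i) (recenter u j) = adj i j.
Proof. by move=> hi hj; rewrite /adj !up_recenter. Qed.

Definition nbrs (i : nat) : seq nat := [seq j <- iota 0 70 | adj i j].

Lemma no_C4_window :
  all (fun a => all (fun b => all (fun c => (c == a) ||
    all (fun d => (d == b) || ~~ adj d a) (nbrs c)) (nbrs b)) (nbrs a)) (iota 30 10).
Proof. by vm_compute. Qed.

(** Neighbours differ by at most 11, so [b] and [d] are within 11 of [a] and [c] within 22:
    recentering at [a] brings the whole cycle into the window. *)
Lemma adj_C4_free (a b c d : nat) : a != c -> b != d ->
  adj a b -> adj b c -> adj c d -> adj d a -> False.
Proof.
move=> ac bd ab bc cd da.
have [[? ?] [? ?]] := (adj_dist ab, adj_dist da).
have [? ?] := adj_dist bc.
have [ha hb hc hd] : [/\ a <= a + 30, a <= b + 30, a <= c + 30 & a <= d + 30].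
  by split; lia.
have mem_nbrs i j : a <= i + 30 -> a <= j + 30 -> j <= a + 30 -> adj i j ->
    recenter a j \in nbrs (recenter a i).
  by move=> hi hj lj ij; rewrite mem_filter adj_recenter // ij mem_iota recenter_lt.
have /allP h1 := no_C4_window; have /allP h2 := h1 _ (recenter_self a).
have /allP h3 := h2 _ (mem_nbrs _ _ ha hb ltac:(lia) ab).
have := h3 _ (mem_nbrs _ _ hb hc ltac:(lia) bc).
case/orP=> [/eqP/recenter_inj e|/allP h4]; first by rewrite e ?eqxx in ac.
have := h4 _ (mem_nbrs _ _ hc hd ltac:(lia) cd); rewrite adj_recenter // da orbF.
by move=> /eqP/recenter_inj e; rewrite e ?eqxx in bd.
Qed.

(** * Crossings, and vertices on edges *)

Definition window_edges : seq (nat * nat) :=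
  [seq (x, x + s.1) | x <- iota 0 70, s <- steps x].

Lemma mem_window_edges (x y : nat) : up x y -> x < 70 -> (x, y) \in window_edges.
Proof.
move=> xy x70; have [lt _ _] := up_bounds xy.
have -> : (x, y) = (x, x + (y - x, dx x y).1) by rewrite /= subnKC // ltnW.
by apply/allpairsPdep; exists x, (y - x, dx x y); rewrite mem_iota x70 mem_steps.
Qed.

(* The horizontal periods [-20, -10, 0, 10, 20] are indexed by [K < 5]. *)
Definition offx (u x K : nat) : Z := (col x - col u + 10 * (Z.of_nat K - 2))%Z.
Definition offy (u x : nat) : Z := (Z.of_nat x - Z.of_nat u)%Z.

Definition edge_det (u v x y : nat) : Z :=
  cross (dx u v) (offy u v) (dx x y) (offy x y).

(* The height tests discard collinear but disjoint translates of one edge, which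
   [meetb] reports as meeting. *)
Definition edges_meet (u v : nat) (c : nat * nat * nat) : bool :=
  let: (x, y, K) := c in
  [&& x < v, u < y &
      meetb (dx u v) (offy u v) (dx x y) (offy x y) (offx u x K) (offy u x)].

Definition meetings (u v : nat) : seq (nat * nat * nat) :=
  [seq c <- [seq (e, K) | e <- window_edges, K <- iota 0 5] |
    (c.1 != (u, v)) && edges_meet u v c].

(** Pairs of an edge and a period are counted, so an edge met on two different turns around the
    cylinder would count twice. *)
Lemma meetings_window :
  all (fun e => (size (meetings e.1 e.2) <= 1) &&
        all (fun c => edge_det e.1 e.2 c.1.1 c.1.2 != 0%Z) (meetings e.1 e.2))
    [seq e <- window_edges | e.1 \in iota 30 10].
Proof. by vm_compute. Qed.

(** At a height strictly between the ends, lying on the edge amounts to the vanishing of one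
    determinant. *)
Definition hits_dot (u v w K : nat) : bool :=
  [&& (0 <? offy u w)%Z, (offy u w <? offy u v)%Z &
      (cross (offx u w K) (offy u w) (dx u v) (offy u v) =? 0)%Z].

Lemma hits_dot_window :
  all (fun e => all (fun w => all (fun K => ~~ hits_dot e.1 e.2 w K) (iota 0 5)) (iota 0 70))
    [seq e <- window_edges | e.1 \in iota 30 10].
Proof. by vm_compute. Qed.

Lemma scaled_bound (s : R) (z : Z) :
  (0 <= s <= 1)%Re -> (-6 <= z <= 6)%Z -> (-6 <= s * IZR z <= 6)%Re.
Proof. by move=> s01 [/IZR_le ? /IZR_le ?]; nra. Qed.

Lemma period_index (k : Z) : (-3 < k < 3)%Z ->
  exists2 K : nat, K \in iota 0 5 & (Z.of_nat K - 2 = k)%Z.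
Proof. by move=> k3; exists (Z.to_nat (k + 2)); rewrite ?mem_iota; lia. Qed.

(** Unrolling the cylinder turns a common point into a crossing of two plane segments, one of them
    shifted by a period. Equal heights force the vertical ranges to overlap, so both edges fit in
    the window around [u]. *)
Lemma arcs_meet (u v x y : nat) (s t : R) :
  up u v -> up x y -> (x, y) <> (u, v) -> (0 < s < 1)%Re -> (0 < t < 1)%Re ->
  arcs u v s = arcs x y t ->
  u <= x + 30 /\ exists2 K : nat,
    (recenter u x, recenter u y, K) \in meetings (recenter u u) (recenter u v) &
    (s * IZR (edge_det u v x y) = IZR (cross (offx u x K) (offy u x) (dx x y) (offy x y)))%Re.
Proof.
move=> uv xy ne s01 t01 /wrap_inj [ey [k ex]].
have [uv1 uv2 duv] := up_bounds uv; have [xy1 xy2 dxy] := up_bounds xy.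
have lift i j : i < j -> (IZR (Z.of_nat i) < IZR (Z.of_nat j))%Re.
  by move=> ij; apply: IZR_lt; lia.
have drop i j : (IZR (Z.of_nat i) < IZR (Z.of_nat j))%Re -> i < j.
  by move/lt_IZR; lia.
have [lu lx] := (lift _ _ uv1, lift _ _ xy1).
have xv : x < v by apply: drop; nra.
have uy : u < y by apply: drop; nra.
have b1 := @scaled_bound s _ ltac:(lra) duv.
have b2 := @scaled_bound t _ ltac:(lra) dxy.
have [/IZR_le c1 /IZR_le c2] := col_bounds u.
have [/IZR_le c3 /IZR_le c4] := col_bounds x.
(* Columns differ by at most 9 and each displacement contributes at most 6, so [10 * k] is at most
   21 in absolute value. *)
have [K K5 eK] : exists2 K : nat, K \in iota 0 5 & (Z.of_nat K - 2 = k)%Z.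
  by apply: period_index; split; apply: lt_IZR; lra.
have [hu hv hx hy] : [/\ u <= u + 30, u <= v + 30, u <= x + 30 & u <= y + 30].
  by split; lia.
have e1 : (s * IZR (dx u v) = IZR (offx u x K) + t * IZR (dx x y))%Re.
  by rewrite /offx eK plus_IZR minus_IZR mult_IZR; lra.
have e2 : (s * IZR (offy u v) = IZR (offy u x) + t * IZR (offy x y))%Re.
  by rewrite /offy !minus_IZR; lra.
have [m es] := meetP s01 t01 e1 e2.
split=> //; exists K => //; rewrite mem_filter; apply/andP; split.
  rewrite /edges_meet /offx /offy !dx_recenter // !recenter_sub // !col_recenter //.
  rewrite m andbT; apply/and3P; split; last by rewrite /recenter; lia.
    rewrite xpair_eqE; apply/negP => /andP [/eqP /recenter_inj ex' /eqP /recenter_inj ey'].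
    by apply: ne; rewrite (ex' hx hu) (ey' hy hv).
  by rewrite /recenter; lia.
apply: (allpairs_f pair) => //; apply: mem_window_edges; first by rewrite up_recenter.
by apply: recenter_lt; lia.
Qed.

Lemma base_edge (u v : nat) : up u v ->
  (recenter u u, recenter u v) \in [seq e <- window_edges | e.1 \in iota 30 10].
Proof.
move=> uv; have [? ? _] := up_bounds uv.
rewrite mem_filter recenter_self mem_window_edges ?up_recenter ?recenter_lt //; lia.
Qed.

(** Both crossings yield members of a list of length at most one, so the other edge and the period
    agree; both parameters then solve the same linear equation with nonzero coefficient. *)
Lemma arcs_cross_once (u v x1 y1 x2 y2 : nat) (s1 t1 s2 t2 : R) :
  up u v -> up x1 y1 -> up x2 y2 -> (x1, y1) <> (u, v) -> (x2, y2) <> (u, v) ->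
  (0 < s1 < 1)%Re -> (0 < t1 < 1)%Re -> (0 < s2 < 1)%Re -> (0 < t2 < 1)%Re ->
  arcs u v s1 = arcs x1 y1 t1 -> arcs u v s2 = arcs x2 y2 t2 ->
  [/\ x1 = x2, y1 = y2 & s1 = s2].
Proof.
move=> uv xy1 xy2 n1 n2 s01 t01 s02 t02 a1 a2.
have [h1 [K1 m1 e1]] := arcs_meet uv xy1 n1 s01 t01 a1.
have [h2 [K2 m2 e2]] := arcs_meet uv xy2 n2 s02 t02 a2.
have [lt1 _ _] := up_bounds xy1; have [lt2 _ _] := up_bounds xy2.
have [ltuv _ _] := up_bounds uv.
have /allP := meetings_window => /(_ _ (base_edge uv)) /andP [/= sz /allP ndeg].
have : (recenter u x1, recenter u y1, K1) == (recenter u x2, recenter u y2, K2).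
  move: sz m1 m2; case: (meetings _ _) => [|c [|]] //= _.
  by rewrite !inE => /eqP -> /eqP ->.
rewrite !xpair_eqE => /andP [/andP [/eqP /recenter_inj ex /eqP /recenter_inj ey] /eqP eK].
have [ex' ey'] : x1 = x2 /\ y1 = y2 by split; [apply: ex | apply: ey]; lia.
split=> //; subst x2 y2 K2.
have := ndeg _ m1; rewrite /= /edge_det !dx_recenter ?/offy ?recenter_sub; try lia.
move=> /eqP nz; rewrite -e1 in e2.
apply: (Rmult_eq_reg_r (IZR (edge_det u v x1 y1))) => //.
by move=> /eq_IZR; apply: nz.
Qed.

Lemma arcs_avoid_dots (u v w : nat) (s : R) :
  up u v -> (0 < s < 1)%Re -> arcs u v s <> dots w.
Proof.
move=> uv s01 /wrap_inj [ey [k ex]].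
have [uv1 uv2 duv] := up_bounds uv.
have luv : (IZR (Z.of_nat u) < IZR (Z.of_nat v))%Re by apply: IZR_lt; lia.
have uw : u < w by have : (Z.of_nat u < Z.of_nat w)%Z by [apply: lt_IZR; nra]; lia.
have wv : w < v by have : (Z.of_nat w < Z.of_nat v)%Z by [apply: lt_IZR; nra]; lia.
have b1 := @scaled_bound s _ ltac:(lra) duv.
have [/IZR_le c1 /IZR_le c2] := col_bounds u.
have [/IZR_le c3 /IZR_le c4] := col_bounds w.
(* Here [10 * k] is at most [9 + 6] in absolute value. *)
have [K K5 eK] : exists2 K : nat, K \in iota 0 5 & (Z.of_nat K - 2 = k)%Z.
  by apply: period_index; split; apply: lt_IZR; lra.
have w70 : recenter u w \in iota 0 70 by rewrite mem_iota recenter_lt //; lia.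
have /allP := hits_dot_window => /(_ _ (base_edge uv)) /allP /(_ _ w70) /allP /(_ _ K5).
case/negP; rewrite /hits_dot /offx /offy /= !dx_recenter ?recenter_sub ?col_recenter; try lia.
apply/and3P; split; [lia|lia|].
apply/Z.eqb_spec/eq_IZR.
have e1 : (s * IZR (dx u v) = IZR (col w - col u + 10 * (Z.of_nat K - 2)))%Re.
  by rewrite eK plus_IZR minus_IZR mult_IZR; lra.
have e2 : (s * IZR (Z.of_nat v - Z.of_nat u) = IZR (Z.of_nat w - Z.of_nat u))%Re.
  by rewrite !minus_IZR; lra.
by rewrite /cross minus_IZR !mult_IZR -e1 -e2; ring.
Qed.

(** * The truncated graph and its drawing *)

Definition helix (n : nat) : rel 'I_n := fun u v => adj u v.

Lemma adj_up (i j : nat) : i < j -> adj i j -> up i j.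
Proof. by move=> ij /orP [//|/up_bounds [ji _ _]]; lia. Qed.

Lemma helix_simple (n : nat) : simple_graph (@helix n).
Proof.
split=> [u v|u]; first by rewrite /helix /adj orbC.
by apply/negbTE/negP => /orP [] /up_bounds [uu _ _]; lia.
Qed.

Lemma helix_C4_free (n : nat) : C4_free (@helix n).
Proof.
move=> a b c d; rewrite /= !inE !negb_or => /and4P [/and3P [_ ac _] /andP [_ bd] _ _].
exact: adj_C4_free.
Qed.

Lemma helix_one_planar (n : nat) : one_planar (@helix n).
Proof.
exists (fun u => dots u), (fun u v => arcs u v); split.
  split=> [u v /dots_inj /val_inj //|u v uv /(adj_up uv) uuv].
  split; first exact: arcs_is_arc.
  by split; [exact: arcs0 | split=> [|w t t01]; [exact: arcs1 | exact: arcs_avoid_dots]].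
have ne_val (u v x y : 'I_n) : (x, y) <> (u, v) -> (x : nat, y : nat) <> (u : nat, v : nat).
  by move=> ne [/val_inj ex /val_inj ey]; apply: ne; rewrite ex ey.
move=> u v uv /(adj_up uv) uuv x1 y1 x2 y2 p1 p2.
move=> [lt1 [/(adj_up lt1) u1 [/ne_val n1 [s1 [t1 [s01 [t01 [a1 b1]]]]]]]].
move=> [lt2 [/(adj_up lt2) u2 [/ne_val n2 [s2 [t2 [s02 [t02 [a2 b2]]]]]]]].
rewrite -a1 in b1; rewrite -a2 in b2.
have [ex ey es] := arcs_cross_once uuv u1 u2 n1 n2 s01 t01 s02 t02 (esym b1) (esym b2).
by split; [exact: val_inj | split; [exact: val_inj | rewrite -a1 -a2 es]].
Qed.

(** * Counting edges *)

Definition cell_edges : seq (nat * nat) := [seq e <- window_edges | e.1 < 10].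

Lemma size_cell_edges : size cell_edges = 24.
Proof. by vm_compute. Qed.

Lemma nth_cell_edges (j : 'I_24) : let e := nth (0, 0) cell_edges j in
  [/\ e.1 < e.2, e.1 < 10, e.2 <= 20 & up e.1 e.2].
Proof.
have /allP h : all (fun e => [&& e.1 < e.2, e.1 < 10, e.2 <= 20 & up e.1 e.2]) cell_edges.
  by vm_compute.
by apply/and4P; apply: h; rewrite mem_nth // size_cell_edges.
Qed.

(** The first [q] translates of the 24 edges of one period are distinct, and their upper ends are at
    most [20 + 10 * (q - 1)], hence below [n]. *)
Lemma helix_num_edges (n q : nat) : q * 10 + 10 < n -> q * 24 <= num_edges (@helix n).
Proof.
case: n => // n qn.
pose f (c : 'I_q * 'I_24) : 'I_n.+1 * 'I_n.+1 :=
  let e := nth (0, 0) cell_edges c.2 in (inord (e.1 + c.1 * 10), inord (e.2 + c.1 * 10)).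
have bound (c : 'I_q * 'I_24) k : k <= 20 -> k + c.1 * 10 < n.+1.
  by move=> k20; have := ltn_ord c.1; lia.
have f_inj : injective f.
  move=> [a i] [b j]; rewrite /f /=.
  have [? ? ? _] := nth_cell_edges i; have [? ? ? _] := nth_cell_edges j.
  move=> [] /(congr1 val) /= e1 /(congr1 val) /= e2; move: e1 e2.
  rewrite !inordK ?(bound (a, i)) ?(bound (b, j)) //; try lia; move=> e1 e2.
  (* Lower ends in [cell_edges] are below 10, so the quotient by 10 recovers the translate. *)
  have ab : a = b by apply: val_inj => /=; lia.
  subst b; move/addIn: e1 => e1; move/addIn: e2 => e2.
  congr pair; apply: val_inj => /=; apply/eqP.
  have un : uniq cell_edges by vm_compute.
  rewrite -(nth_uniq (0, 0) _ _ un) ?size_cell_edges ?ltn_ord //.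
  by rewrite (surjective_pairing (nth _ _ i)) e1 e2 -surjective_pairing.
have <- : #|[set f c | c in [set: 'I_q * 'I_24]]| = q * 24.
  by rewrite card_imset // cardsT card_prod !card_ord.
apply/subset_leq_card/subsetP => _ /imsetP [[a i] _ ->]; rewrite inE /f /helix /=.
have [? ? ? uij] := nth_cell_edges i.
rewrite !inordK ?(bound (a, i)) //; try lia.
by rewrite /adj up_shift uij ltn_add2r; lia.
Qed.

Theorem theorem7 :
  exists C : R, exists N : nat, forall n : nat, (N <= n)%N ->
    exists e : rel 'I_n,
      simple_graph e /\ C4_free e /\ one_planar e /\
      Rle (Rminus (Rmult (Rdiv 12 5) (INR n)) C) (INR (num_edges e)).
Proof.
(* With [q = (n - 11) %/ 10] one has [10 * q >= n - 20], so at least [2.4 * (n - 20) = 2.4 * n - 48]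
   edges are counted. *)
exists 48%Re, 11 => n n11; exists (@helix n).
split; first exact: helix_simple.
split; first exact: helix_C4_free.
split; first exact: helix_one_planar.
have := @helix_num_edges n ((n - 11) %/ 10) ltac:(lia).
set m := num_edges _ => hm.
have /IZR_le : (12 * Z.of_nat n <= 5 * Z.of_nat m + 240)%Z by lia.
by rewrite plus_IZR !mult_IZR -!INR_IZR_INZ; lra.
Qed.
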